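(* Let $p>0$ and let $\mathcal{S}_p=\{x^{-p}e^{ix} : 1<x<\infty\}\subset\mathbb{C}$. Let $0<\alpha\leq 1\leq\beta<\infty$. If $f:(0,1)\to\mathcal{S}_p$ is an $(\alpha,\beta)$-Hölder homeomorphism (onto $\mathcal{S}_p$), then $$\beta\geq\frac{p\alpha}{p-\alpha}.$$
   Context: For $X,Y\subset\mathbb{C}$ and $0<\alpha\leq1\leq\beta<\infty$, a homeomorphism $f:X\to Y$ is $(\alpha,\beta)$-Hölder if there is a constant $C>0$ such that $C^{-1}|x-y|^\beta\leq|f(x)-f(y)|\leq C|x-y|^\alpha$ for all $x,y\in X$. (Under the hypotheses one always has $\alpha<p$, so the denominator $p-\alpha$ is positive.) *)

(* Defs.v *)
From Stdlib Require Import Reals.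
From Coquelicot Require Import Coquelicot.

Open Scope R_scope.

(* Maps between subsets X, Y of C are represented by functions C -> C whose
   values outside X are irrelevant.  [continuous_on X f] is continuity for the
   subspace topology of X (the filter [within X (locally x)]). *)
Definition homeomorphism_between (X Y : C -> Prop) (f : C -> C) : Prop :=
  exists g : C -> C,
    (forall x, X x -> Y (f x)) /\
    (forall y, Y y -> X (g y)) /\
    (forall x, X x -> g (f x) = x) /\
    (forall y, Y y -> f (g y) = y) /\
    continuous_on X f /\
    continuous_on Y g.

(* t ^ a for t >= 0 and a > 0.  [Rpower] cannot be used directly, because
   [Rpower 0 a = 1], whereas 0 ^ a = 0. *)
Definition pow_nonneg (t a : R) : R :=
  if Rlt_dec 0 t then Rpower t a else 0.

Definition holder_homeomorphism (alpha beta : R) (X Y : C -> Prop)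
    (f : C -> C) : Prop :=
  homeomorphism_between X Y f /\
  exists K : R, 0 < K /\
    forall x y : C, X x -> X y ->
      / K * pow_nonneg (Cmod (x - y)) beta <= Cmod (f x - f y) /\
      Cmod (f x - f y) <= K * pow_nonneg (Cmod (x - y)) alpha.

Definition open_unit_interval (z : C) : Prop :=
  exists t : R, 0 < t < 1 /\ z = RtoC t.

Definition cis (x : R) : C := (cos x, sin x).

Definition spiral (p : R) (z : C) : Prop :=
  exists x : R, 1 < x /\ z = (RtoC (Rpower x (- p)) * cis x)%C.

(* Main.v *)
(** Along the spiral, two points half a turn apart near parameter [pi n] are at
    distance at least of order [n^(-p)], so their preimages are at distance at
    least of order [n^(-p/alpha)].  Preimages come in monotone order, hence the
    preimages of the parameters [pi n] and [2 pi n] are at distance at least of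
    order [n^(1-p/alpha)].  The images are within [2 (pi n)^(-p)] of each other,
    so the lower Hölder bound forces [beta (1 - p/alpha) <= -p], which contains
    both conclusions. *)

Require Import Defs.
From Stdlib Require Import Reals Lra Lia.
From Coquelicot Require Import Coquelicot.

(** * Real-variable preliminaries: increments of injective continuous functions *)

Lemma exp_monotone (x y : R) : x <= y -> exp x <= exp y.
Proof.
  intros [Hlt| ->]; [left; now apply exp_increasing | apply Rle_refl].
Qed.

(** A level strictly between [Rmax (u a) (u c)] and [u b] is attained on both sides of [b] by the
    intermediate value theorem. Injectivity merges the two points into [b] itself, where the value
    is too large. *)
Lemma injective_no_interior_max (u : R -> R) (a b c : R) :
  a < b -> b < c ->
  (forall x, a <= x <= c -> continuity_pt u x) ->
  (forall x y, a <= x <= c -> a <= y <= c -> u x = u y -> x = y) ->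
  u a < u b -> u c < u b -> False.
Proof.
  intros Hab Hbc Hcont Hinj Ha Hc.
  assert (Hy : exists y, u a < y /\ u c < y /\ y < u b).
  { exists ((Rmax (u a) (u c) + u b) / 2).
    destruct (Rle_dec (u a) (u c)).
    - rewrite Rmax_right by lra. lra.
    - rewrite Rmax_left by lra. lra. }
  destruct Hy as (y & Hay & Hcy & Hyb).
  destruct (Ranalysis5.IVT_interv (fun x => u x - y) a b) as (z1 & Hz1 & E1); try lra.
  { intros x Hx. apply continuity_pt_minus.
    - apply Hcont; lra.
    - apply continuity_pt_const. intros ? ?; reflexivity. }
  destruct (Ranalysis5.IVT_interv (fun x => y - u x) b c) as (z2 & Hz2 & E2); try lra.
  { intros x Hx. apply continuity_pt_minus.
    - apply continuity_pt_const. intros ? ?; reflexivity.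
    - apply Hcont; lra. }
  assert (z1 = z2) by (apply Hinj; lra).
  assert (Eb : z1 = b) by lra.
  rewrite Eb in E1. lra.
Qed.

(** The two increments have the same sign: turning back at [b] would create an interior maximum of
    [u] or of [- u]. *)
Lemma injective_dist_add (u : R -> R) (a b c : R) :
  a < b -> b < c ->
  (forall x, a <= x <= c -> continuity_pt u x) ->
  (forall x y, a <= x <= c -> a <= y <= c -> u x = u y -> x = y) ->
  Rabs (u c - u a) = Rabs (u c - u b) + Rabs (u b - u a).
Proof.
  intros Hab Hbc Hcont Hinj.
  assert (Nab : u a <> u b) by (intro E; apply Hinj in E; lra).
  assert (Nbc : u b <> u c) by (intro E; apply Hinj in E; lra).
  destruct (Rlt_or_le (u a) (u b)); destruct (Rlt_or_le (u b) (u c)).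
  - rewrite !Rabs_pos_eq by lra. lra.
  - exfalso. apply (injective_no_interior_max u a b c); auto; lra.
  - exfalso. apply (injective_no_interior_max (fun x => - u x) a b c); auto; try lra.
    + intros x Hx. apply continuity_pt_opp. auto.
    + intros x y Hx Hy E. apply Hinj; auto; lra.
  - rewrite !Rabs_left by lra. lra.
Qed.

Lemma injective_dist_progression (u : R -> R) (a h d : R) (m : nat) :
  0 < h ->
  (forall x, a <= x -> continuity_pt u x) ->
  (forall x y, a <= x -> a <= y -> u x = u y -> x = y) ->
  (forall k, (k < m)%nat ->
     d <= Rabs (u (a + INR k * h + h) - u (a + INR k * h))) ->
  INR m * d <= Rabs (u (a + INR m * h) - u a).
Proof.
  intros Hh Hcont Hinj. induction m as [|m IH]; intros Hd.
  - simpl. rewrite Rmult_0_l. apply Rabs_pos.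
  - assert (Hlast := Hd m (Nat.lt_succ_diag_r m)).
    assert (IH' : INR m * d <= Rabs (u (a + INR m * h) - u a)) by (apply IH; auto).
    rewrite S_INR.
    replace (a + (INR m + 1) * h) with (a + INR m * h + h) by ring.
    (* The first increment stands apart because additivity needs the middle point strictly to the
       right of [a]. *)
    destruct m as [|m].
    + simpl in *. replace (a + 0 * h) with a in * by ring. lra.
    + assert (0 < INR (S m) * h).
      { apply Rmult_lt_0_compat; auto. apply lt_0_INR. lia. }
      rewrite (injective_dist_add u a (a + INR (S m) * h)); try lra.
      * intros x Hx. apply Hcont; lra.
      * intros x y Hx Hy. apply Hinj; lra.
Qed.

(** * Geometry and continuity of the spiral *)

Definition spiral_point (p x : R) : C := (RtoC (Rpower x (- p)) * cis x)%C.

Lemma Cmod_cis (x : R) : Cmod (cis x) = 1.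
Proof.
  unfold Cmod, cis; simpl.
  replace (cos x * (cos x * 1) + sin x * (sin x * 1)) with 1.
  - apply sqrt_1.
  - generalize (sin2_cos2 x). unfold Rsqr. lra.
Qed.

Lemma Cmod_spiral_point (p x : R) : Cmod (spiral_point p x) = Rpower x (- p).
Proof.
  unfold spiral_point. rewrite Cmod_mult, Cmod_cis, Cmod_R, Rmult_1_r.
  apply Rabs_pos_eq. left. apply exp_pos.
Qed.

Lemma spiral_point_inj (p x y : R) :
  0 < p -> 0 < x -> 0 < y -> spiral_point p x = spiral_point p y -> x = y.
Proof.
  intros Hp Hx Hy E. apply (f_equal Cmod) in E. rewrite !Cmod_spiral_point in E.
  unfold Rpower in E. apply exp_inv in E. apply Rmult_eq_reg_l in E; [|lra].
  now apply ln_inv.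
Qed.

(** Half a turn reverses the direction [cis x], so the two moduli add up; the smaller one is
    dropped. *)
Lemma spiral_point_half_turn (p x : R) :
  Rpower x (- p) <= Cmod (spiral_point p (x + PI) - spiral_point p x)%C.
Proof.
  replace (spiral_point p (x + PI) - spiral_point p x)%C
    with (RtoC (- (Rpower (x + PI) (- p) + Rpower x (- p))) * cis x)%C.
  - rewrite Cmod_mult, Cmod_cis, Cmod_R, Rmult_1_r, Rabs_Ropp.
    assert (0 < Rpower x (- p)) by apply exp_pos.
    assert (0 < Rpower (x + PI) (- p)) by apply exp_pos.
    rewrite Rabs_pos_eq; lra.
  - unfold spiral_point, cis. rewrite neg_cos, neg_sin.
    unfold Cmult, Cminus, Cplus, Copp, RtoC; simpl. f_equal; ring.
Qed.

Lemma continuous_spiral_point (p x : R) :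
  0 < x -> continuous (spiral_point p : R -> C) x.
Proof.
  intros Hx.
  apply continuous_ext with
    (f := fun y => (Rpower y (- p) * cos y, Rpower y (- p) * sin y)).
  { intros y. unfold spiral_point, cis, Cmult, RtoC; simpl. f_equal; ring. }
  apply (continuous_comp_2 (fun y => Rpower y (- p) * cos y)
           (fun y => Rpower y (- p) * sin y) (pair : R -> R -> C)).
  - apply (ex_derive_continuous (K := R_AbsRing) (V := R_NormedModule)).
    unfold Rpower. auto_derive. auto.
  - apply (ex_derive_continuous (K := R_AbsRing) (V := R_NormedModule)).
    unfold Rpower. auto_derive. auto.
  (* Uncurried, pairing is the identity of the product. *)
  - apply continuous_ext with (f := fun z : C => z); [now intros []|].
    apply continuous_id.
Qed.

Lemma spiral_pullback_continuous (p : R) (g : C -> C) (x : R) :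
  continuous_on (spiral p) g -> 1 < x ->
  continuity_pt (fun y => fst (g (spiral_point p y))) x.
Proof.
  intros Hg Hx. apply continuity_pt_filterlim.
  apply (filterlim_comp _ _ _ (fun y => g (spiral_point p y)) fst _
           (locally (g (spiral_point p x)))).
  - apply (filterlim_comp _ _ _ (spiral_point p) g _
             (within (spiral p) (locally (spiral_point p x)))).
    + intros P HP. unfold filtermap.
      (* Continuity of [g] is relative to the spiral, so nearby points must be shown to lie on it;
         this holds because [1 < y] is an open condition. *)
      assert (Hl : locally x (fun y => spiral p (spiral_point p y) ->
                                       P (spiral_point p y))).
      { apply (continuous_spiral_point p x ltac:(lra) (fun z => spiral p z -> P z) HP). }
      apply (filter_imp (fun y => (spiral p (spiral_point p y) ->
                                   P (spiral_point p y)) /\ 1 < y)).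
      * intros y [Hy H1]. apply Hy. now exists y.
      * apply filter_and; [exact Hl|]. now apply open_gt.
    + apply Hg. now exists x.
  - destruct (g (spiral_point p x)) as [a b]. apply continuous_fst.
Qed.

(** * Logarithmic estimates for the preimages *)

Lemma ln_multiple_bounded_nonpos (c M : R) :
  (forall n, (1 <= n)%nat -> c * ln (INR n) <= M) -> c <= 0.
Proof.
  intros H. apply Rnot_lt_le. intros Hc.
  destruct (INR_unbounded (exp (Rabs M / c + 1))) as [n Hn].
  assert (0 < exp (Rabs M / c + 1)) by apply exp_pos.
  assert (1 <= n)%nat.
  { destruct n; [simpl in Hn; lra | lia]. }
  assert (Hln : Rabs M / c + 1 < ln (INR n)).
  { rewrite <- (ln_exp (Rabs M / c + 1)). apply ln_increasing; lra. }
  specialize (H n ltac:(assumption)).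
  assert (HM := Rle_abs M).
  apply (Rmult_lt_compat_l c) in Hln; auto.
  replace (c * (Rabs M / c + 1)) with (Rabs M + c) in Hln by (field; lra).
  lra.
Qed.

Lemma pow_nonneg_pos (t a : R) : 0 < t -> pow_nonneg t a = Rpower t a.
Proof. intros Ht. unfold pow_nonneg. destruct (Rlt_dec 0 t); [auto|lra]. Qed.

Section PreimageParameter.

(** Here [u x] plays the real coordinate of the preimage of [spiral_point p x]. Restricting to
    [x <> y] keeps distances positive, so that [Rpower] is the true power. *)
Variables (p alpha beta K : R) (u : R -> R).
Hypotheses (Hp : 0 < p) (Halpha : 0 < alpha) (Hbeta : 0 < beta) (HK : 0 < K).
Hypothesis u_cont : forall x, 1 < x -> continuity_pt u x.
Hypothesis u_inj : forall x y, 1 < x -> 1 < y -> u x = u y -> x = y.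
Hypothesis u_holder : forall x y, 1 < x -> 1 < y -> x <> y ->
  / K * Rpower (Rabs (u x - u y)) beta
    <= Cmod (spiral_point p x - spiral_point p y)%C
    <= K * Rpower (Rabs (u x - u y)) alpha.

Lemma preimage_dist_pos (x y : R) :
  1 < x -> 1 < y -> x <> y -> 0 < Rabs (u x - u y).
Proof.
  intros Hx Hy Hxy. apply Rabs_pos_lt. intro E. apply Hxy, u_inj; auto. lra.
Qed.

(** The upper Hölder bound is solved for the preimage distance by taking logarithms. Since the
    radius decreases, replacing [x] by [y] gives one bound for all half turns starting before
    [y]. *)
Lemma preimage_half_turn (x y : R) :
  1 < x -> x <= y ->
  exp ((- p * ln y - ln K) / alpha) <= Rabs (u (x + PI) - u x).
Proof.
  intros Hx Hxy. assert (HPI := PI_RGT_0).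
  assert (Hd := preimage_dist_pos (x + PI) x ltac:(lra) Hx ltac:(lra)).
  destruct (u_holder (x + PI) x ltac:(lra) Hx ltac:(lra)) as [_ Hup].
  assert (Hturn := spiral_point_half_turn p x).
  assert (Hle : Rpower x (- p) <= K * Rpower (Rabs (u (x + PI) - u x)) alpha) by lra.
  apply ln_le in Hle; [|apply exp_pos].
  rewrite ln_mult in Hle; [|auto|apply exp_pos].
  unfold Rpower in Hle. rewrite !ln_exp in Hle.
  assert (Hln : ln x <= ln y) by (apply ln_le; lra).
  apply (Rmult_le_compat_l p) in Hln; [|lra].
  rewrite <- (exp_ln (Rabs (u (x + PI) - u x))) by auto.
  apply exp_monotone.
  apply (Rmult_le_reg_l alpha); auto.
  replace (alpha * ((- p * ln y - ln K) / alpha)) with (- p * ln y - ln K)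
    by (field; lra).
  lra.
Qed.

(** This is the logarithm of the comparison between the parameters [n * PI] and [2 * n * PI]; the
    right-hand side collects everything independent of [n]. *)
Lemma preimage_exponent_bound (n : nat) :
  (1 <= n)%nat ->
  (beta - beta * p / alpha + p) * ln (INR n)
    <= ln K + ln 2 - p * ln PI + beta * (p * ln (2 * PI) + ln K) / alpha.
Proof.
  intros Hn. assert (HPI := PI_RGT_0). assert (HPI1 := PI2_1).
  assert (HN : 1 <= INR n) by (apply (le_INR 1); auto).
  set (N := INR n) in *.
  set (a := N * PI).
  assert (Ha : 1 < a).
  { unfold a. apply Rlt_le_trans with (1 * PI); [lra|].
    apply Rmult_le_compat_r; lra. }
  (* All [n] half turns start between [a] and [2 * a], so [d] bounds each of them from below. *)
  set (d := exp ((- p * ln (2 * a) - ln K) / alpha)).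
  assert (Hd : 0 < d) by apply exp_pos.
  assert (Hfar : N * d <= Rabs (u (a + N * PI) - u a)).
  { apply injective_dist_progression; auto.
    - intros x Hx. apply u_cont. lra.
    - intros x y Hx Hy. apply u_inj; lra.
    - intros k Hk. apply lt_INR in Hk. fold N in Hk.
      assert (0 <= INR k * PI) by (apply Rmult_le_pos; [apply pos_INR|lra]).
      assert (Hkn : INR k * PI <= N * PI) by (apply Rmult_le_compat_r; lra).
      fold a in Hkn. apply preimage_half_turn; lra. }
  (* As [N * PI] is [a], the progression ends at [a + a]. *)
  fold a in Hfar.
  assert (HNd : 0 < N * d) by (apply Rmult_lt_0_compat; lra).
  destruct (u_holder (a + a) a) as [Hlow _]; try lra.
  assert (Hclose : Cmod (spiral_point p (a + a) - spiral_point p a)%C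
                   <= 2 * Rpower a (- p)).
  { eapply Rle_trans; [apply Cmod_triangle|].
    rewrite Cmod_opp, !Cmod_spiral_point.
    assert (Rpower (a + a) (- p) <= Rpower a (- p)).
    { unfold Rpower. apply exp_monotone.
      assert (Hln : ln a <= ln (a + a)) by (apply ln_le; lra).
      apply (Rmult_le_compat_l p) in Hln; lra. }
    lra. }
  assert (Hpow : Rpower (N * d) beta <= K * (2 * Rpower a (- p))).
  { apply Rle_trans with (Rpower (Rabs (u (a + a) - u a)) beta).
    - apply Rle_Rpower_l; lra.
    - apply (Rmult_le_reg_l (/ K)); [now apply Rinv_0_lt_compat|].
      rewrite <- Rmult_assoc, Rinv_l by lra. lra. }
  apply ln_le in Hpow; [|apply exp_pos].
  assert (0 < Rpower a (- p)) by apply exp_pos.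
  rewrite !ln_mult in Hpow by lra.
  unfold Rpower in Hpow. rewrite !ln_exp in Hpow.
  rewrite ln_mult in Hpow by lra.
  unfold d in Hpow. rewrite ln_exp in Hpow.
  replace (2 * a) with (2 * PI * N) in Hpow by (unfold a; ring).
  rewrite (ln_mult (2 * PI) N) in Hpow by lra.
  unfold a in Hpow. rewrite (ln_mult N PI) in Hpow by lra.
  (* With all terms on one side, [Hpow] and the goal are the same expression up to field
     identities. *)
  apply Rminus_le. apply Rle_minus in Hpow.
  eapply Rle_trans; [|exact Hpow]. right. field. lra.
Qed.

End PreimageParameter.

Theorem theorem2p2 :
  forall (p alpha beta : R) (f : C -> C),
    0 < p ->
    0 < alpha -> alpha <= 1 -> 1 <= beta ->
    holder_homeomorphism alpha beta open_unit_interval (spiral p) f ->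
    alpha < p /\ p * alpha / (p - alpha) <= beta.
Proof.
  intros p alpha beta f Hp Ha Ha1 Hb
    ((g & _ & HgX & _ & Hfg & _ & Hgc) & K & HK & Hhold).
  (* The values of [g] on the spiral are real, so the first coordinate determines them. *)
  set (u := fun x => fst (g (spiral_point p x))).
  assert (Hsp : forall x, 1 < x -> spiral p (spiral_point p x)).
  { intros x Hx. now exists x. }
  assert (Hgu : forall x, 1 < x -> g (spiral_point p x) = RtoC (u x)).
  { intros x Hx. unfold u. destruct (HgX _ (Hsp x Hx)) as (t & _ & ->).
    reflexivity. }
  assert (Hinj : forall x y, 1 < x -> 1 < y -> u x = u y -> x = y).
  { intros x y Hx Hy E. apply (spiral_point_inj p); try lra.
    rewrite <- (Hfg _ (Hsp x Hx)), <- (Hfg _ (Hsp y Hy)), !Hgu, E; auto. }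
  assert (Hlog : beta - beta * p / alpha + p <= 0).
  (* The bound [M] is left open and filled by the constant of [preimage_exponent_bound]. *)
  { eapply ln_multiple_bounded_nonpos. intros n Hn.
    apply (preimage_exponent_bound p alpha beta K u); auto; try lra.
    - intros x Hx. now apply spiral_pullback_continuous.
    - intros x y Hx Hy Hxy.
      assert (Hpos : 0 < Rabs (u x - u y)) by (apply preimage_dist_pos; auto).
      destruct (Hhold (g (spiral_point p x)) (g (spiral_point p y))) as [Hl Hu];
        auto.
      rewrite !Hfg in Hl, Hu by auto.
      rewrite !Hgu in Hl, Hu by auto.
      rewrite <- RtoC_minus, Cmod_R, pow_nonneg_pos in Hl, Hu by auto.
      auto. }
  assert (Hmain : p * alpha <= beta * (p - alpha)).
  { apply (Rmult_le_compat_l alpha) in Hlog; [|lra].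
    replace (alpha * (beta - beta * p / alpha + p))
      with (alpha * beta - beta * p + p * alpha) in Hlog by (field; lra).
    lra. }
  assert (0 < p * alpha) by (apply Rmult_lt_0_compat; lra).
  assert (Hap : alpha < p).
  (* If [p <= alpha], the right side of [Hmain] is nonpositive, while its left side is positive. *)
  { apply Rnot_le_lt. intros Hle.
    assert (0 <= beta * (alpha - p)) by (apply Rmult_le_pos; lra). lra. }
  split; auto.
  apply (Rmult_le_reg_r (p - alpha)); [lra|].
  unfold Rdiv. rewrite Rmult_assoc, Rinv_l, Rmult_1_r by lra. lra.
Qed.
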